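(* Let $\Phi=(w(z),x(z),y(z))$ be an analytic curve in $\mathbb{CP}^3$ on the unit disc $\mathcal{D}$, with lifting $f=(1,w,x,y)$ to $\mathbb{C}^4\setminus\{0\}$ such that $f,f',f'',f'''$ are linearly independent. Put $\sigma_{ijk}=w^{(i)}x^{(j)}y^{(k)}-w^{(i)}x^{(k)}y^{(j)}$ and $\Delta=\sigma_{123}+\sigma_{231}+\sigma_{312}$, which is the determinant $\det[f,f',f'',f''']$. Let $\lambda=\Delta^{-1/4}$ (so $\lambda^4\Delta=1$), and let $$g_0=0,\quad g_1=\frac{\sigma_{423}+\sigma_{342}+\sigma_{234}}{\Delta},\quad g_2=-\frac{\sigma_{413}+\sigma_{341}+\sigma_{134}}{\Delta},\quad g_3=\frac{\sigma_{412}+\sigma_{241}+\sigma_{124}}{\Delta},$$ so that $f^{(4)}=g_0f+g_1f'+g_2f''+g_3f'''$. Let $H_j$ ($j=0,1,2$) be the $4\times4$ matrix obtained by deleting the $(j+1)$st column of $$H=\begin{bmatrix}\lambda&\lambda'&\lambda''&\lambda'''&\lambda^{(4)}+\lambda g_0\\0&\lambda&2\lambda'&3\lambda''&4\lambda'''+\lambda g_1\\0&0&\lambda&3\lambda'&6\lambda''+\lambda g_2\\0&0&0&\lambda&4\lambda'+\lambda g_3\end{bmatrix}.$$ Then the Schwarzian curvatures of $\Phi$ are $$\begin{aligned}\kappa_0=-\Delta\det H_0=-\Delta\big(&\lambda^2{\lambda'}^2g_1+6\lambda{\lambda'}^3g_3-12{\lambda'}^3\lambda''+2\lambda^2{\lambda'}^2g_2-3\lambda^2\lambda'\lambda''g_3-24\lambda{\lambda'}^2\lambda''\\&-3\lambda{\lambda'}^2\lambda''g_3+24{\lambda'}^4+\lambda^3\lambda''g_2+6\lambda^2{\lambda''}^2+\lambda^2\lambda'\lambda'''g_3+8\lambda{\lambda'}^2\lambda'''-\lambda^2\lambda'\lambda^{(4)}\big),\end{aligned}$$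 $$\kappa_1=\Delta\det H_1=\Delta\big(\lambda^4g_1-2\lambda^3\lambda'g_2+6\lambda^2{\lambda'}^2g_3+24\lambda{\lambda'}^3-3\lambda^3\lambda''g_3-24\lambda^2\lambda'\lambda''+4\lambda^3\lambda'''\big),$$ $$\kappa_2=-\Delta\det H_2=-\Delta\big(3\lambda^3\lambda'g_3+12\lambda^2{\lambda'}^2-6\lambda^3\lambda''-\lambda^4g_2\big).$$
   Context: For a curve $\Phi:\mathcal{D}\to\mathbb{CP}^3$ with holomorphic lifting $f:\mathcal{D}\to\mathbb{C}^4\setminus\{0\}$ such that $f,f',f'',f'''$ are linearly independent, choose an analytic $\lambda:\mathcal{D}\to\mathbb{C}\setminus\{0\}$ with $\lambda^4\det[f,f',f'',f''']=1$ and put $\nu=\lambda f$, so that $\det[\nu,\nu',\nu'',\nu''']=1$. Then $\det[\nu,\nu',\nu'',\nu^{(4)}]=0$, so $\nu^{(4)}=\kappa_0\nu+\kappa_1\nu'+\kappa_2\nu''$ for functions $\kappa_0,\kappa_1,\kappa_2$ on $\mathcal{D}$; these are the Schwarzian curvatures of $\Phi$. The triple $(w,x,y)$ denotes inhomogeneous coordinates, i.e. $\Phi(z)=[1:w(z):x(z):y(z)]$. Superscripts in parentheses and primes denote derivatives with respect to $z$.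
   Formalization: In the expansion of det H_0 seven misprinted terms are corrected to λ³λ'g1, −12λλ'²λ'', −2λ²λ'²g2, −3λ²λ'λ''g3 (for −3λλ'²λ''g3), λ³λ'''g3, 8λ²λ'λ''', −λ³λ^(4); as printed the expansion is false. *)

(* Defs.v *)
From HB Require Import structures.
From mathcomp Require Import all_boot all_order all_algebra.
From mathcomp Require Import complex.
From mathcomp Require Import all_classical all_reals all_analysis.

Set Implicit Arguments.
Unset Strict Implicit.
Unset Printing Implicit Defensive.

Import Order.TTheory GRing.Theory Num.Theory.
Import numFieldNormedType.Exports.

Local Open Scope ring_scope.
Local Open Scope classical_set_scope.

(* The topology and the normed module structure are those that the library
   attaches to any numClosedFieldType; they are not declared on the head
   constant of R[i], whence this packaging. *)
Definition CC (R : realType) : numClosedFieldType := (R[i])%C.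
Arguments CC : simpl never.

Definition unit_disc (R : realType) : set (CC R) := [set z | `|z| < 1].
Arguments unit_disc R : clear implicits.

Definition analytic_on (R : realType) (V : normedModType (CC R))
    (D : set (CC R)) (f : CC R -> V) : Prop :=
  forall a, D a -> exists c : nat -> V,
    \forall z \near a, [series (z - a) ^+ n *: c n]_n @ \oo --> f z.

(* A point of CP^3 is a line of C^4, so that [v0 : v1 : v2 : v3] is <[v]>%VS
   for v != 0.  Only the values of Phi on D matter. *)
Definition is_lifting (R : realType) (D : set (CC R))
    (Phi : CC R -> {vspace 'rV[CC R]_4}) (f : CC R -> 'rV[CC R]_4) : Prop :=
  analytic_on D f /\
  forall z, D z -> f z != 0 /\ Phi z = <[f z]>%VS.

(* The rows are f z, f' z, f'' z, f''' z. *)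
Definition jet (R : realType) (f : CC R -> 'rV[CC R]_4) (z : CC R) :
    'M[CC R]_4 :=
  \matrix_(i < 4) f^`(i)%classic z.

(* The triple does not depend on the choice of f and lam: two normalized
   liftings nu of Phi differ by a constant fourth root of unity.  It is
   determined on D only. *)
Definition schwarzian_curvatures (R : realType) (D : set (CC R))
    (Phi : CC R -> {vspace 'rV[CC R]_4})
    (kappa0 kappa1 kappa2 : CC R -> CC R) : Prop :=
  exists (f : CC R -> 'rV[CC R]_4) (lam : CC R -> CC R),
    [/\ is_lifting D Phi f,
        forall z, D z -> row_free (jet f z),
        analytic_on D lam,
        forall z, D z -> lam z != 0 /\ lam z ^+ 4 * \det (jet f z) = 1
      & let nu := fun z => lam z *: f z in
        forall z, D z -> nu^`(4)%classic z =
          kappa0 z *: nu z + kappa1 z *: nu^`(1)%classic z + kappa2 z *: nu^`(2)%classic z].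

Definition row4 (R : realType) (a b c d : CC R) : 'rV[CC R]_4 :=
  \row_j [:: a; b; c; d]`_j.

Definition affine_lifting (R : realType) (w x y : CC R -> CC R) :
    CC R -> 'rV[CC R]_4 :=
  fun z => row4 1 (w z) (x z) (y z).

Definition sigma (R : realType) (w x y : CC R -> CC R) (i j k : nat) :
    CC R -> CC R :=
  fun z => w^`(i)%classic z * x^`(j)%classic z * y^`(k)%classic z - w^`(i)%classic z * x^`(k)%classic z * y^`(j)%classic z.

Definition Delta (R : realType) (w x y : CC R -> CC R) : CC R -> CC R :=
  fun z => sigma w x y 1 2 3 z + sigma w x y 2 3 1 z + sigma w x y 3 1 2 z.

Definition g0 (R : realType) (w x y : CC R -> CC R) : CC R -> CC R :=
  fun=> 0.

Definition g1 (R : realType) (w x y : CC R -> CC R) : CC R -> CC R :=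
  fun z => (sigma w x y 4 2 3 z + sigma w x y 3 4 2 z + sigma w x y 2 3 4 z) / Delta w x y z.

Definition g2 (R : realType) (w x y : CC R -> CC R) : CC R -> CC R :=
  fun z => - ((sigma w x y 4 1 3 z + sigma w x y 3 4 1 z + sigma w x y 1 3 4 z) / Delta w x y z).

Definition g3 (R : realType) (w x y : CC R -> CC R) : CC R -> CC R :=
  fun z => (sigma w x y 4 1 2 z + sigma w x y 2 4 1 z + sigma w x y 1 2 4 z) / Delta w x y z.

Definition Hmx (R : realType) (w x y lam : CC R -> CC R) (z : CC R) :
    'M[CC R]_(4, 5) :=
  let l0 := lam z in let l1 := lam^`(1)%classic z in
  let l2 := lam^`(2)%classic z in let l3 := lam^`(3)%classic z in
  let l4 := lam^`(4)%classic z in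
  \matrix_(i < 4, j < 5)
    (nth [::]
      [:: [:: l0; l1; l2; l3; l4 + l0 * g0 w x y z];
          [:: 0; l0; 2 * l1; 3 * l2; 4 * l3 + l0 * g1 w x y z];
          [:: 0; 0; l0; 3 * l1; 6 * l2 + l0 * g2 w x y z];
          [:: 0; 0; 0; l0; 4 * l1 + l0 * g3 w x y z]] i)`_j.

(* Columns are numbered from 0, so this deletes the (j+1)st one. *)
Definition Hdel (R : realType) (w x y lam : CC R -> CC R) (j : 'I_5)
    (z : CC R) : 'M[CC R]_4 :=
  col' j (Hmx w x y lam z).

(* Main.v *)
Require Import Defs.
From HB Require Import structures.
From mathcomp Require Import all_boot all_order all_algebra.
From mathcomp Require Import complex.
From mathcomp Require Import all_classical all_reals all_analysis.
From mathcomp Require Import ring.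

Set Implicit Arguments.
Unset Strict Implicit.
Unset Printing Implicit Defensive.

Import Order.TTheory GRing.Theory Num.Theory.
Import numFieldNormedType.Exports.

Local Open Scope ring_scope.
Local Open Scope classical_set_scope.

(** The affine lifting has first coordinate 1, so every lifting of [Phi] is
    [mu] times it, with [mu] the analytic first coordinate. For two normalized
    liftings the quotient [c] of the scalar factors satisfies [c ^ 4 = 1];
    differentiating gives [c' = 0], so all derivatives of the two liftings are
    proportional and satisfy the same equation, and it suffices to treat
    [nu = lambda f].
    By Leibniz, the columns of [H] are the coordinates of [nu, ..., nu^(4)] in
    the frame [f, f', f'', f''']; the last coordinate of the equation for
    [nu^(4)] is [4 lambda' + lambda g3 = 0], the derivative of
    [lambda ^ 4 Delta = 1], and the other three form a triangular system for
    the curvatures. That analytic functions have derivatives of all orders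
    comes from termwise differentiation of power series. *)

(** * Termwise differentiation of complex power series *)

Lemma cvg_le_norm (K : numFieldType) (V : normedModType K) (u : nat -> V)
    (l : V) (B : K) :
  u @ \oo --> l -> (forall n, `|u n| <= B) -> `|l| <= B.
Proof.
move=> ul uB.
(* [K] is only partially ordered; lying above a norm makes [B] nonnegative, hence comparable with
   the norm of [l]. *)
have B0 : 0 <= B by apply: le_trans (uB 0%N).
rewrite real_leNgt ?ger0_real//; apply/negP => Bl.
have e0 : 0 < `|l| - B by rewrite subr_gt0.
move/cvgrPdist_lt : ul => /(_ _ e0) [N _ /(_ N (leqnn N))] /=.
rewrite ltrBrDr; apply/negP; rewrite -real_leNgt ?realD ?normr_real ?ger0_real//.
by rewrite -[leLHS](congr1 _ (subrK (u N) l)) (le_trans (ler_normD _ _))// lerD2l.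
Qed.

Lemma sum_half_le (K : numFieldType) (n : nat) :
  \sum_(0 <= k < n) (2%:R^-1 : K) ^+ k <= 2.
Proof.
suff -> : \sum_(0 <= k < n) (2%:R^-1 : K) ^+ k = 2 - 2 * 2^-1 ^+ n.
  by rewrite lerBlDr lerDl mulr_ge0// exprn_ge0// invr_ge0.
elim: n => [|n ih]; first by rewrite big_nil expr0 mulr1 subrr.
rewrite big_nat_recr//= ih exprS mulrA divff ?pnatr_eq0//; ring.
Qed.

(** Real and imaginary parts of the terms are dominated by a real geometric series, so completeness
    of [R] sums them separately; the two limits recombine into a complex one. *)
Lemma cvg_series_half_dominated (R : realType) (u : nat -> CC R) (M : CC R) :
  (forall n, `|u n| <= M * 2^-1 ^+ n) -> exists l : CC R, series u @ \oo --> l.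
Proof.
move=> uM.
suff [l Hl] : exists l : CC R, forall e : CC R, 0 < e ->
    \forall n \near \oo, `|l - series u n| < e.
  by exists l; apply/cvgrPdist_lt.
(* Lying above a norm, [M] is nonnegative, hence the image of a real number [m]. *)
have M0 : 0 <= M by have := le_trans (normr_ge0 _) (uM 0%N); rewrite mulr1.
pose m : R := complex.Re M.
have Mm : M = (m%:C)%C by rewrite /m RRe_real// ger0_real.
have halfC n : (2^-1 ^+ n : CC R) = ((2^-1 ^+ n : R)%:C)%C.
  by rewrite rmorphXn/= fmorphV/= rmorph_nat.
have cvg_part (P : CC R -> R) : (forall z, (`|P z|%:C)%C <= `|z|) ->
    cvgn (series (P \o u)).
  move=> Pz; apply: normed_cvg.
  apply: (@series_le_cvg _ _ (geometric m 2^-1)) => [n|n|n|] /=.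
  - exact: normr_ge0.
  - by rewrite mulr_ge0 ?exprn_ge0 ?invr_ge0// -lecR -Mm.
  - rewrite -lecR; apply: le_trans (Pz _) _.
    by apply: le_trans (uM n) _; rewrite Mm halfC -rmorphM.
  - by apply: is_cvg_geometric_series; rewrite ger0_norm ?invr_ge0// invf_lt1// ltr1n.
have normi : `|'i%C| = 1 :> R[i].
  by rewrite normc_def/= expr0n expr1n add0r sqrtr1.
have ReP z : (`|complex.Re z|%:C)%C <= `|z| :> CC R by exact: normc_ge_Re.
(* The imaginary part of [z] is the real part of [- i z], which has the same norm. *)
have ImP z : (`|complex.Im z|%:C)%C <= `|z| :> CC R.
  have := normc_ge_Re (z * -'i%C).
  rewrite normrM normrN normi mulr1.
  by rewrite mulrN raddfN/= ReiNIm opprK.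
have /cvg_ex[/= a Ha] := cvg_part _ ReP.
have /cvg_ex[/= b Hb] := cvg_part _ ImP.
pose l : CC R := (a +i* b)%C.
exists l => e e0.
pose r : R := complex.Re e.
have er : e = (r%:C)%C by rewrite /r RRe_real// gtr0_real.
have r0 : 0 < r / 2 by rewrite divr_gt0// -ltcR -er.
move/cvgrPdist_lt : Ha => /(_ _ r0) Ha; move/cvgrPdist_lt : Hb => /(_ _ r0) Hb.
near=> n.
have an : `|a - series (@complex.Re R \o u) n| < r / 2 by near: n.
have bn : `|b - series (@complex.Im R \o u) n| < r / 2 by near: n.
have -> : l - series u n =
  ((a - series (@complex.Re R \o u) n) +i* (b - series (@complex.Im R \o u) n))%C.
  have ReD (x y : R[i]) : complex.Re (x + y) = complex.Re x + complex.Re y.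
    by case: x => ? ?; case: y.
  have ImD (x y : R[i]) : complex.Im (x + y) = complex.Im x + complex.Im y.
    by case: x => ? ?; case: y.
  rewrite /series /= -(big_morph _ ReD (erefl : @complex.Re R 0 = 0)).
  rewrite -(big_morph _ ImD (erefl : @complex.Im R 0 = 0)).
  by move: (\sum_(0 <= k < n) u k) => [].
rewrite er (splitr r); set s := a - _; set t := b - _.
have -> : (s +i* t)%C = (s%:C)%C + 'i%C * (t%:C)%C.
  by rewrite [LHS]complexE.
apply: le_lt_trans (ler_normD _ _) _.
rewrite normrM normi mul1r !normc_def/= !expr0n/= !addr0 !sqrtr_sqr.
by rewrite -rmorphD/= ltcR ltrD.
Unshelve. all: by end_near. Qed.

(** Passing from [n] to [n.+1] multiplies the second-order remainder by [x] and adds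
    [n y^(n-1) (x - y)^2]; the crude constant [2 ^ n] survives because [n <= 2 ^ n]. The factor
    [rho ^ 2] on the left avoids the exponent [n - 2], which would be negative for small [n]. *)
Lemma norm_exprB_taylor (K : numFieldType) (x y rho : K) (n : nat) :
  `|x| <= rho -> `|y| <= rho ->
  `|x ^+ n - y ^+ n - (x - y) * (n%:R * y ^+ n.-1)| * rho ^+ 2
    <= 2 ^+ n * rho ^+ n * `|x - y| ^+ 2.
Proof.
move=> xr yr; have r0 : 0 <= rho by exact: le_trans xr.
elim: n => [|n ih].
  by rewrite !expr0 subrr mul0r mulr0 subrr normr0 !mul1r mul0r exprn_ge0.
have -> : x ^+ n.+1 - y ^+ n.+1 - (x - y) * (n.+1%:R * y ^+ n.+1.-1) =
    x * (x ^+ n - y ^+ n - (x - y) * (n%:R * y ^+ n.-1)) +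
    n%:R * y ^+ n.-1 * (x - y) ^+ 2.
  by case: n {ih} => [|n]/=; rewrite ?expr0 ?exprS -?natr1; ring.
apply: (@le_trans _ _ (rho * (2 ^+ n * rho ^+ n * `|x - y| ^+ 2) +
    n%:R * rho ^+ n.+1 * `|x - y| ^+ 2)).
  apply: le_trans (ler_wpM2r (exprn_ge0 _ r0) (ler_normD _ _)) _.
  rewrite mulrDl lerD//.
    by rewrite normrM -mulrA ler_pM// mulr_ge0// exprn_ge0.
  rewrite normrM normrX (normrM n%:R) normrX normr_nat [leLHS]mulrAC.
  apply: ler_wpM2r; rewrite ?exprn_ge0//.
  case: n {ih} => [|n] /=; first by rewrite !mul0r.
  rewrite -mulrA ler_wpM2l// -[n.+2]addn2 exprD ler_wpM2r ?exprn_ge0//.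
  by rewrite lerXn2r ?nnegrE.
have -> : rho * (2 ^+ n * rho ^+ n * `|x - y| ^+ 2) +
    n%:R * rho ^+ n.+1 * `|x - y| ^+ 2 =
    (2 ^+ n + n%:R) * rho ^+ n.+1 * `|x - y| ^+ 2 by rewrite (exprS rho); ring.
rewrite !ler_wpM2r ?exprn_ge0//.
have -> : 2 ^+ n.+1 = 2 ^+ n + 2 ^+ n :> K by rewrite exprS; ring.
rewrite lerD2l.
by rewrite -natrX ler_nat ltnW// ltn_expl.
Qed.

Lemma is_derive_of_taylor1 (K : numFieldType) (f : K -> K) (y dy e B : K) :
  0 < e -> 0 <= B ->
  (forall x, `|x - y| < e -> `|f x - f y - (x - y) * dy| <= B * `|x - y| ^+ 2) ->
  is_derive y 1 f dy.
Proof.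
move=> e0 B0 fB.
have H : h^-1 *: ((f \o shift y) (h *: 1) - f y) @[h --> 0^'] --> dy.
  apply/cvgrPdist_le => eps eps0; near=> h.
  have h0 : h != 0 by near: h; exact: nbhs_dnbhs_neq.
  have he : `|h| < e by near: h; exact: dnbhs0_lt.
  (* The denominator is [B + 1] because [B] may be 0. *)
  have hB : `|h| < eps / (B + 1).
    by near: h; apply: dnbhs0_lt; rewrite divr_gt0// ltr_wpDl.
  rewrite /= [h%:A]mulr1 -[X in X <= _](mulKf (_ : `|h| != 0)) ?normr_eq0//.
  rewrite ler_pdivrMl ?normr_gt0// -normrM mulrBr -[_ *: _]/(_ * _) mulVKf//.
  rewrite distrC; have := fB (h + y); rewrite addrK => /(_ he)/le_trans; apply.
  rewrite expr2 mulrA mulrC ler_wpM2l//.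
  apply: le_trans (ler_wpM2l B0 (ltW hB)) _.
  by rewrite mulrA ler_pdivrMr ?ltr_wpDl// mulrC ler_wpM2l ?(ltW eps0)// lerDl.
have dfy : derivable f y 1 by apply/cvg_ex; exists dy.
by apply: DeriveDef => //; apply: cvg_lim H.
Unshelve. all: by end_near. Qed.

(* The form of completeness needed to sum the derived power series. *)
Definition half_complete (K : numFieldType) := forall (u : nat -> K) (M : K),
  (forall n, `|u n| <= M * 2^-1 ^+ n) -> exists l : K, series u @ \oo --> l.

Section PowerSeries.
Variable K : numFieldType.
Hypothesis Kcomplete : half_complete K.
Variables (c : nat -> K) (r M : K).
Hypotheses (r0 : 0 < r) (cM : forall n, `|c n| * r ^+ n <= M).
Let rho := r / 4.

Let rho0 : 0 < rho. Proof. by rewrite divr_gt0. Qed.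
Let M0 : 0 <= M.
Proof. by apply: le_trans (cM 0%N); rewrite mulr_ge0// exprn_ge0// ltW. Qed.

(** Since [4 rho = r], the bound on [c n * r ^ n] leaves two factors [2 ^ n]: one absorbs polynomial
    factors in [n], the other gives geometric decay. *)
Let cM2 n : `|c n| * (2 ^+ n * rho ^+ n) <= M * 2^-1 ^+ n.
Proof.
apply: le_trans (ler_wpM2r _ (cM n)); last by rewrite exprn_ge0// invr_ge0.
rewrite -mulrA ler_wpM2l// -!exprMn le_eqVlt; apply/orP; left; apply/eqP.
by congr (_ ^+ n); rewrite /rho; field.
Qed.

Lemma cvg_derived_pseries (x : K) : `|x| <= rho ->
  exists l : K, [series x ^+ n * (n.+1%:R * c n.+1)]_n @ \oo --> l.
Proof.
(* The index shift in the derived series costs one power of [rho], hence the constant [M / rho]. *)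
move=> xr; apply: (Kcomplete (M := M / rho)) => n.
rewrite mulrAC ler_pdivlMr//.
apply: (@le_trans _ _ (`|c n.+1| * (2 ^+ n.+1 * rho ^+ n.+1))); last first.
  apply: le_trans (cM2 _) _; rewrite ler_wpM2l// exprS ler_piMl ?exprn_ge0 ?invr_ge0//.
  by rewrite invf_le1// ler1n.
have -> : `|c n.+1| * (2 ^+ n.+1 * rho ^+ n.+1) =
    (rho ^+ n * (2 ^+ n.+1 * `|c n.+1|)) * rho by rewrite (exprS rho); ring.
rewrite ler_wpM2r ?(ltW rho0)// !normrM normrX normr_nat.
apply: ler_pM => //; rewrite ?mulr_ge0 ?exprn_ge0//.
  by rewrite lerXn2r ?nnegrE// ltW.
by rewrite ler_wpM2r// -natrX ler_nat ltnW// ltn_expl.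
Qed.

(** The remainder bound for monomials is summed against the coefficients; the constant 2 is the
    bound for the sum of the powers of 1/2. The bound passes to the limit of the partial sums. *)
Lemma pseries_taylor1 (x y sx sy dy : K) : `|x| <= rho -> `|y| <= rho ->
  [series x ^+ n * c n]_n @ \oo --> sx ->
  [series y ^+ n * c n]_n @ \oo --> sy ->
  [series y ^+ n * (n.+1%:R * c n.+1)]_n @ \oo --> dy ->
  `|sx - sy - (x - y) * dy| * rho ^+ 2 <= 2 * M * `|x - y| ^+ 2.
Proof.
move=> xr yr hx hy hd.
rewrite -ler_pdivlMr ?exprn_gt0//.
(* The constant term has derivative 0, so [n] terms of the derived series match [n.+1] terms of the
   original one. *)
have shiftS (u : nat -> K) (l : K) :
    u @ \oo --> l -> (fun n => u n.+1) @ \oo --> l.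
  by rewrite -(cvg_shiftS u).
pose S x := [series x ^+ n * c n]_n.
have hlim : (fun n => S x n.+1 - S y n.+1 -
    (x - y) * [series y ^+ n * (n.+1%:R * c n.+1)]_n n) @ \oo -->
    sx - sy - (x - y) * dy.
  apply: cvgB; first by apply: cvgB; apply: shiftS.
  by apply: cvgM hd; exact: cvg_cst.
apply: (cvg_le_norm hlim) => n.
rewrite ler_pdivlMr ?exprn_gt0//.
have -> : S x n.+1 - S y n.+1 -
   (x - y) * [series y ^+ n * (n.+1%:R * c n.+1)]_n n =
   \sum_(0 <= k < n.+1)
     (x ^+ k - y ^+ k - (x - y) * (k%:R * y ^+ k.-1)) * c k.
  transitivity (\sum_(0 <= k < n.+1) x ^+ k * c k - \sum_(0 <= k < n.+1) y ^+ k * c k -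
     (x - y) * \sum_(0 <= k < n.+1) k%:R * y ^+ k.-1 * c k).
    congr (_ - _ - _ * _); rewrite [RHS]big_nat_recl//= !mul0r add0r.
    by apply: eq_bigr => k _; rewrite mulrA [_ * k.+1%:R]mulrC.
  rewrite mulr_sumr -!sumrB; apply: eq_bigr => k _; ring.
apply: (@le_trans _ _ (M * `|x - y| ^+ 2 * \sum_(0 <= k < n.+1) (2^-1) ^+ k)).
  apply: le_trans (ler_wpM2r (exprn_ge0 _ (ltW rho0)) (ler_norm_sum _ _ _)) _.
  rewrite mulr_suml mulr_sumr; apply: ler_sum => k _.
  rewrite normrM mulrAC.
  apply: le_trans (ler_wpM2r _ (norm_exprB_taylor k xr yr)) _ => //.
  have -> : 2 ^+ k * rho ^+ k * `|x - y| ^+ 2 * `|c k| =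
     `|x - y| ^+ 2 * (`|c k| * (2 ^+ k * rho ^+ k)) by ring.
  by rewrite [leRHS]mulrAC [leRHS]mulrC ler_wpM2l ?exprn_ge0.
rewrite [leLHS]mulrC -[leRHS]mulrA ler_wpM2r ?mulr_ge0 ?exprn_ge0//.
exact: sum_half_le.
Qed.

End PowerSeries.


Lemma near_pseries_derivable (K : numFieldType) (f : K -> K) (c : nat -> K)
    (a : K) : half_complete K ->
  (\forall z \near a, [series (z - a) ^+ n * c n]_n @ \oo --> f z) ->
  \forall z \near a, derivable f z 1 /\
    [series (z - a) ^+ n * (n.+1%:R * c n.+1)]_n @ \oo --> f^`()%classic z.
Proof.
move=> Kc /nbhs_ballP[e e0 fc].
(* Boundedness of the terms at a + r yields geometric bounds on the ball of
   radius r / 4, since 2 ^ n absorbs the factors n and n ^ 2. *)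
pose r := e / 2; have r0 : 0 < r by rewrite divr_gt0.
have re : r < e by rewrite ltr_pdivrMr// ltr_pMr// ltr1n.
have [M cM] : exists M, forall n, `|c n| * r ^+ n <= M.
  have : cvgn [series (r + a - a) ^+ n * c n]_n.
    apply/cvg_ex; exists (f (r + a)); apply: fc.
    by rewrite -ball_normE/= opprD addrCA subrr addr0 normrN gtr0_norm.
  move/cvg_series_cvg_0 => /cvgP/cvg_seq_bounded[M [Mr HM]].
  exists (M + 1) => n; have := HM (M + 1); rewrite ltrDl ltr01 => /(_ isT n I).
  by rewrite /= addrK normrM normrX gtr0_norm// mulrC.
have rho0 : 0 < r / 4 by rewrite divr_gt0.
have rhor : r / 4 <= r by rewrite ler_pdivrMr// ler_peMr ?(ltW r0)// ler1n.
have M0 : 0 <= M by apply: le_trans (cM 0%N); rewrite mulr_ge0// exprn_ge0// ltW.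
have ser z : `|z - a| <= r / 4 -> [series (z - a) ^+ n * c n]_n @ \oo --> f z.
  move=> za; apply: fc; rewrite -ball_normE/= distrC.
  by apply: le_lt_trans za _; apply: le_lt_trans re.
apply/nbhs_ballP; exists (r / 4) => //= z; rewrite -ball_normE/= distrC => za.
have [g zg] := cvg_derived_pseries Kc r0 cM (ltW za).
have fz : is_derive z 1 f g.
  (* This radius around [z] keeps [x] in the disc of radius [r / 4] around [a], where the estimate
     holds. *)
  apply: (@is_derive_of_taylor1 _ _ _ _ (r / 4 - `|z - a|) (2 * M / (r / 4) ^+ 2)).
  - by rewrite subr_gt0.
  - by rewrite divr_ge0 ?(mulr_ge0 _ M0)// exprn_ge0// ltW.
  move=> x xz; have xa : `|x - a| <= r / 4.
    rewrite -(subrK z x) -addrA (le_trans (ler_normD _ _))//.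
    by rewrite -lerBrDr ltW.
  rewrite mulrAC ler_pdivlMr ?exprn_gt0//.
  have := pseries_taylor1 r0 cM xa (ltW za) (ser _ xa) (ser _ (ltW za)) zg.
  by rewrite opprB addrA subrK.
split; first exact: ex_derive.
by rewrite derive1E derive_val.
Qed.

(** * Derivatives of all orders on an open set *)

Definition smooth_on (K : numFieldType) (V : normedModType K) (D : set K)
    (f : K -> V) : Prop :=
  forall n z, D z -> derivable f^`(n)%classic z 1.

(** The derived series represents [f'] on a whole neighbourhood of each point, so [f'] is again
    analytic and the argument can be iterated. *)
Lemma analytic_on_derive1 (R : realType) (D : set (CC R)) (f : CC R -> CC R) :
  analytic_on D f -> (forall z, D z -> derivable f z 1) /\ analytic_on D f^`()%classic.
Proof.
move=> fD; have Kc : half_complete (CC R) by exact: cvg_series_half_dominated.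
split=> z Dz; have [c fc] := fD z Dz; have := near_pseries_derivable Kc fc => H.
  exact: (proj1 (nbhs_singleton H)).
exists (fun n => n.+1%:R * c n.+1).
exact: (filterS (fun x => @proj2 _ _) H).
Qed.

Lemma analytic_smooth (R : realType) (D : set (CC R)) (f : CC R -> CC R) :
  analytic_on D f -> smooth_on D f.
Proof.
move=> fD n; apply: (proj1 (analytic_on_derive1 _)).
elim: n => [|n ih]; first exact: fD.
exact: (proj2 (analytic_on_derive1 ih)).
Qed.

(** A matrix has finitely many entries, so the neighbourhood conditions on them can be imposed
    simultaneously. *)
Lemma cvg_mxE (K : numFieldType) (T : Type) (F : set_system T) (m n : nat)
    (f : T -> 'M[K]_(m, n)) (M : 'M[K]_(m, n)) : Filter F ->
  (f @ F --> M) <-> (forall i j, (fun x => f x i j) @ F --> M i j).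
Proof.
move=> FF; split=> [fM i j|fM].
  apply/cvg_app_entourageP => A entA; near=> x.
  have : forall i j, (M i j, f x i j) \in A.
    by near: x; move/cvg_mx_entourageP : fM; exact.
  by move=> /(_ i j)/set_mem.
apply/cvg_mx_entourageP => A entA; near=> x => i j; apply/mem_set.
move: i j; near: x; do 2 apply: filter_forall => ?.
by move: A entA; apply/cvg_app_entourageP; apply: fM.
Unshelve. all: by end_near. Qed.

Section SmoothCalculus.
Variables (K : numFieldType) (D : set K).
Hypothesis oD : open D.

Lemma eq_on_derive1n (V : normedModType K) (f g : K -> V) (n : nat) :
  (forall z, D z -> f z = g z) ->
  forall z, D z -> f^`(n)%classic z = g^`(n)%classic z.
Proof.
move=> fg; elim: n => [|n ih] z Dz; first exact: fg.
rewrite !derive1nS !derive1E; apply: near_eq_derive.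
by near=> x; apply: ih; near: x; exact: open_nbhs_nbhs.
Unshelve. all: by end_near. Qed.

Lemma is_derive_mx (m n : nat) (F : K -> 'M[K]_(m, n)) (z : K)
    (dF : 'M[K]_(m, n)) :
  (forall i j, is_derive z 1 (fun x => F x i j) (dF i j)) -> is_derive z 1 F dF.
Proof.
move=> HF.
have H : h^-1 *: ((F \o shift z) (h *: 1) - F z) @[h --> 0^'] --> dF.
  apply/cvg_mxE => i j; have [/cvg_ex[l Hl] E] := HF i j.
  have El : l = dF i j by rewrite -E; apply/esym/cvg_lim.
  by rewrite -El; move: Hl; under [in X in _ -> X]eq_fun do rewrite !mxE.
have dfy : derivable F z 1 by apply/cvg_ex; exists dF.
by apply: DeriveDef => //; apply: cvg_lim H.
Qed.

Lemma derive1n_mx (m n : nat) (F : K -> 'M[K]_(m, n)) :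
  (forall i j, smooth_on D (fun x => F x i j)) ->
  forall k z, D z -> F^`(k)%classic z =
    \matrix_(i, j) (fun x => F x i j)^`(k)%classic z.
Proof.
move=> sF; elim=> [|k ih] z Dz; first by apply/matrixP => i j; rewrite mxE.
rewrite derive1nS derive1E.
(* The induction hypothesis holds on the open set [D], hence near [z], so it may be
   differentiated. *)
have <- := near_eq_derive 1
  (f := fun z => \matrix_(i, j) (fun x => F x i j)^`(k)%classic z).
  apply: derive_val; apply: is_derive_mx => i j; rewrite mxE derive1nS derive1E.
  under eq_fun do rewrite mxE.
  by apply: derivableP; apply: sF.
by near=> x; apply/esym/ih; near: x; exact: open_nbhs_nbhs.
Unshelve. all: by end_near. Qed.

End SmoothCalculus.

(** * Pascal's rule and the Leibniz formula for higher derivatives *)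

Lemma sum_binS (K : pzRingType) (a b : nat -> K) (n : nat) :
  \sum_(i < n.+1) 'C(n, i)%:R * (a (n - i).+1 * b i + a (n - i)%N * b i.+1) =
  \sum_(i < n.+2) 'C(n.+1, i)%:R * (a (n.+1 - i)%N * b i).
Proof.
under eq_bigr do rewrite mulrDr.
rewrite big_split/= [RHS]big_ord_recl/= bin0 subn0.
under [in RHS]eq_bigr do rewrite /bump/= add1n binS natrD mulrDl subSS.
rewrite big_split/= addrA; congr (_ + _).
rewrite [in RHS]big_ord_recr/= bin_small// mul0r addr0 [LHS]big_ord_recl/= bin0 subn0.
by congr (_ + _); apply: eq_bigr => i _; rewrite /bump/= add1n subnSK.
Qed.

Section Leibniz.
Variables (K : numFieldType) (D : set K).
Hypothesis oD : open D.

Lemma smooth_is_derive (f : K -> K) n z : smooth_on D f -> D z ->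
  is_derive z 1 f^`(n)%classic (f^`(n.+1)%classic z).
Proof. by move=> sf Dz; rewrite derive1nS derive1E; apply: derivableP; apply: sf. Qed.

Lemma is_derive_mul (f g : K -> K) (z df dg : K) :
  is_derive z 1 f df -> is_derive z 1 g dg ->
  is_derive z 1 (fun x => f x * g x) (df * g z + f z * dg).
Proof.
move=> Hf Hg; apply: (is_derive_eq (is_deriveM Hf Hg)).
by rewrite addrC [g z *: df]mulrC.
Qed.

Lemma is_derive_Leibniz (lam f : K -> K) (n : nat) (z : K) :
  smooth_on D lam -> smooth_on D f -> D z ->
  is_derive z 1
    (fun x => \sum_(i < n.+1) 'C(n, i)%:R *
       (lam^`(n - i)%classic x * f^`(i)%classic x))
    (\sum_(i < n.+2) 'C(n.+1, i)%:R *
       (lam^`(n.+1 - i)%classic z * f^`(i)%classic z)).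
Proof.
move=> sl sf Dz.
rewrite -(sum_binS (fun k => lam^`(k)%classic z) (fun k => f^`(k)%classic z)).
have -> : (fun x => \sum_(i < n.+1) 'C(n, i)%:R *
       (lam^`(n - i)%classic x * f^`(i)%classic x)) =
   \sum_(i < n.+1) (fun x => 'C(n, i)%:R *
       (lam^`(n - i)%classic x * f^`(i)%classic x)).
  by apply/funext => x; rewrite fct_sumE.
apply: is_derive_sum => i.
have H := is_derive_mul (smooth_is_derive (n - i) sl Dz) (smooth_is_derive i sf Dz).
have Hc : is_derive z 1 (fun=> 'C(n, i)%:R : K) 0 by exact: is_derive_cst.
by have := is_derive_mul Hc H; rewrite mul0r add0r.
Qed.

Lemma derive1n_mul (lam f : K -> K) : smooth_on D lam -> smooth_on D f ->
  forall n z, D z -> (fun x => lam x * f x)^`(n)%classic z =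
    \sum_(i < n.+1) 'C(n, i)%:R * (lam^`(n - i)%classic z * f^`(i)%classic z).
Proof.
move=> sl sf; elim=> [|n ih] z Dz; first by rewrite big_ord1 bin0 mul1r.
rewrite derive1nS derive1E; have H := is_derive_Leibniz n sl sf Dz.
rewrite -(derive_val (is_derive := H)); apply: near_eq_derive.
by near=> x; apply: ih; near: x; exact: open_nbhs_nbhs.
Unshelve. all: by end_near. Qed.

Lemma smooth_mul (lam f : K -> K) : smooth_on D lam -> smooth_on D f ->
  smooth_on D (fun x => lam x * f x).
Proof.
move=> sl sf n z Dz; have H := is_derive_Leibniz n sl sf Dz.
apply: ex_derive; apply: (near_eq_is_derive _ H).
by near=> x; apply/esym/derive1n_mul => //; near: x; exact: open_nbhs_nbhs.
Unshelve. all: by end_near. Qed.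

Lemma derive1n_scale (p q : nat) (lam : K -> K) (F : K -> 'M[K]_(p, q)) :
  smooth_on D lam -> (forall i j, smooth_on D (fun x => F x i j)) ->
  forall n z, D z -> (fun x => lam x *: F x)^`(n)%classic z =
    \sum_(i < n.+1) ('C(n, i)%:R * lam^`(n - i)%classic z) *: F^`(i)%classic z.
Proof.
move=> sl sF n z Dz; have scE i j :
    (fun x => (lam x *: F x) i j) = (fun x => lam x * F x i j).
  by apply/funext => x; rewrite mxE.
have slF i j : smooth_on D (fun x => (lam x *: F x) i j).
  by rewrite scE; exact: smooth_mul.
rewrite (derive1n_mx oD slF _ Dz).
apply/matrixP => i j; rewrite mxE scE (derive1n_mul sl (sF i j) _ Dz) summxE.
by apply: eq_bigr => k _; rewrite (derive1n_mx oD sF _ Dz) !mxE mulrA.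
Qed.

(** By Leibniz the jet of [lam F] is a lower triangular matrix times the jet of [F], and every
    diagonal entry of that matrix is [lam z]. *)
Lemma det_jet_scale (n : nat) (lam : K -> K) (F : K -> 'rV[K]_n) :
  smooth_on D lam -> (forall i j, smooth_on D (fun x => F x i j)) ->
  forall z, D z ->
  \det (\matrix_(i < n) (fun x => lam x *: F x)^`(i)%classic z) =
  lam z ^+ n * \det (\matrix_(i < n) F^`(i)%classic z).
Proof.
move=> sl sF z Dz.
pose L : 'M[K]_n := \matrix_(k, i) ('C(k, i)%:R * lam^`(k - i)%classic z).
have -> : \matrix_(i < n) (fun x => lam x *: F x)^`(i)%classic z =
    L *m \matrix_(i < n) F^`(i)%classic z.
  apply/matrixP => k j; rewrite !mxE (derive1n_scale sl sF _ Dz) summxE.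
  (* The Leibniz sum is extended to all [n] rows; the added binomial coefficients vanish. *)
  rewrite (big_ord_widen_leq n) ?ltn_ord//= big_mkcond/=.
  apply: eq_bigr => i _; rewrite !mxE; case: ifPn => ki; first by rewrite inordK.
  by rewrite bin_small ?mul0r// ltnNge.
rewrite det_mulmx det_trig; last first.
  by apply/is_trig_mxP => i j ij; rewrite mxE bin_small// mul0r.
congr (_ * _); rewrite -[in RHS](card_ord n) -prodr_const.
by apply: eq_bigr => i _; rewrite mxE binn subnn mul1r.
Qed.

End Leibniz.

(** * Algebra of moving frames in dimension 4 *)

Lemma det_mx4 (K : comNzRingType) (e : nat -> nat -> K) :
  \det (\matrix_(i < 4, j < 4) e i j) =
    e 0%N 0%N * (e 1%N 1%N * (e 2%N 2%N * e 3%N 3%N - e 2%N 3%N * e 3%N 2%N)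
           - e 1%N 2%N * (e 2%N 1%N * e 3%N 3%N - e 2%N 3%N * e 3%N 1%N)
           + e 1%N 3%N * (e 2%N 1%N * e 3%N 2%N - e 2%N 2%N * e 3%N 1%N))
  - e 0%N 1%N * (e 1%N 0%N * (e 2%N 2%N * e 3%N 3%N - e 2%N 3%N * e 3%N 2%N)
           - e 1%N 2%N * (e 2%N 0%N * e 3%N 3%N - e 2%N 3%N * e 3%N 0%N)
           + e 1%N 3%N * (e 2%N 0%N * e 3%N 2%N - e 2%N 2%N * e 3%N 0%N))
  + e 0%N 2%N * (e 1%N 0%N * (e 2%N 1%N * e 3%N 3%N - e 2%N 3%N * e 3%N 1%N)
           - e 1%N 1%N * (e 2%N 0%N * e 3%N 3%N - e 2%N 3%N * e 3%N 0%N)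
           + e 1%N 3%N * (e 2%N 0%N * e 3%N 1%N - e 2%N 1%N * e 3%N 0%N))
  - e 0%N 3%N * (e 1%N 0%N * (e 2%N 1%N * e 3%N 2%N - e 2%N 2%N * e 3%N 1%N)
           - e 1%N 1%N * (e 2%N 0%N * e 3%N 2%N - e 2%N 2%N * e 3%N 0%N)
           + e 1%N 2%N * (e 2%N 0%N * e 3%N 1%N - e 2%N 1%N * e 3%N 0%N)).
Proof.
do 3 (rewrite ?(expand_det_row _ ord0) ?big_ord_recl ?big_ord0 /cofactor).
rewrite !det_mx11 !mxE /= /bump /= !add0n !addn0 !add1n; ring.
Qed.

Lemma jet_lin_indep (K : fieldType) (v : nat -> 'rV[K]_4) (e0 e1 e2 e3 : K) :
  row_free (\matrix_(i < 4) v i) ->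
  e0 *: v 0%N + e1 *: v 1%N + e2 *: v 2%N + e3 *: v 3%N = 0 ->
  [/\ e0 = 0, e1 = 0, e2 = 0 & e3 = 0].
Proof.
move=> free e_0; pose e : 'rV[K]_4 := \row_i [:: e0; e1; e2; e3]`_i.
have : e *m \matrix_(i < 4) v i = 0.
  rewrite mulmx_sum_row !big_ord_recr big_ord0/= add0r !rowK !mxE/=; exact: e_0.
rewrite -[RHS](mul0mx _ (\matrix_(i < 4) v i)) => /(row_free_inj free) /rowP E.
by split; [have := E 0 | have := E (inord 1) | have := E (inord 2) | have := E (inord 3)];
  rewrite !mxE ?inordK.
Qed.

(** Back-substitution finds [c2], then [c1], then [c0], dividing by [a0] each time. The result
    agrees with the closed formulas only modulo the two hypotheses relating [d], [k3], [a0] and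
    [a1]. *)
Lemma normalized_curvature_equations (K : numFieldType)
    (d a0 a1 a2 a3 a4 k1 k2 k3 c0 c1 c2 : K) :
  a0 ^+ 4 * d = 1 -> 4 * a1 + a0 * k3 = 0 ->
  [/\ a4 - c0 * a0 - c1 * a1 - c2 * a2 = 0,
      4 * a3 + a0 * k1 - c1 * a0 - 2 * c2 * a1 = 0 &
      6 * a2 + a0 * k2 - c2 * a0 = 0] <->
  [/\ c0 = - d * (a0 ^+ 3 * a1 * k1 + 6 * a0 * a1 ^+ 3 * k3
          - 12 * a0 * a1 ^+ 2 * a2 - 2 * a0 ^+ 2 * a1 ^+ 2 * k2
          - 3 * a0 ^+ 2 * a1 * a2 * k3 - 24 * a0 * a1 ^+ 2 * a2
          - 3 * a0 ^+ 2 * a1 * a2 * k3 + 24 * a1 ^+ 4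
          + a0 ^+ 3 * a2 * k2 + 6 * a0 ^+ 2 * a2 ^+ 2
          + a0 ^+ 3 * a3 * k3 + 8 * a0 ^+ 2 * a1 * a3
          - a0 ^+ 3 * a4),
      c1 = d * (a0 ^+ 4 * k1 - 2 * a0 ^+ 3 * a1 * k2
          + 6 * a0 ^+ 2 * a1 ^+ 2 * k3 + 24 * a0 * a1 ^+ 3
          - 3 * a0 ^+ 3 * a2 * k3 - 24 * a0 ^+ 2 * a1 * a2
          + 4 * a0 ^+ 3 * a3) &
      c2 = - d * (3 * a0 ^+ 3 * a1 * k3 + 12 * a0 ^+ 2 * a1 ^+ 2
          - 6 * a0 ^+ 3 * a2 - a0 ^+ 4 * k2)].
Proof.
move=> da ak.
have a0n : a0 != 0.
  by apply: contra_eq_neq da => ->; rewrite expr0n mul0r eq_sym oner_eq0.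
(* With [d] and [k3] eliminated, both directions become rational identities whose denominators are
   powers of [a0]. *)
have -> : d = (a0 ^+ 4)^-1 by rewrite -[RHS]mulr1 -da mulKf ?expf_neq0.
have -> : k3 = - 4 * a1 / a0.
  by apply: (canRL (mulfK a0n)); apply/eqP; rewrite mulNr -addr_eq0 mulrC addrC ak.
split=> [[E0 E1 E2]|[-> -> ->]]; last by split; field.
move: E2 E1 E0 => /eqP; rewrite subr_eq0 => /eqP E2 E1 E0.
have c2E : c2 = (6 * a2 + a0 * k2) / a0 by exact: (canRL (mulfK a0n)).
have c1E : c1 = (4 * a3 + a0 * k1 - 2 * c2 * a1) / a0.
  apply: (canRL (mulfK a0n)); apply/esym/eqP; rewrite -subr_eq0 -E1.
  by apply/eqP; ring.
have c0E : c0 = (a4 - c1 * a1 - c2 * a2) / a0.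
  apply: (canRL (mulfK a0n)); apply/esym/eqP; rewrite -subr_eq0 -E0.
  by apply/eqP; ring.
by rewrite c0E c1E c2E; split; field.
Qed.

Lemma is_derive_mul3 (K : numFieldType) (f g h : K -> K) (z df dg dh : K) :
  is_derive z 1 f df -> is_derive z 1 g dg -> is_derive z 1 h dh ->
  is_derive z 1 (fun x => f x * g x * h x)
    (df * g z * h z + f z * dg * h z + f z * g z * dh).
Proof.
move=> Hf Hg Hh; apply: (is_derive_eq (is_derive_mul (is_derive_mul Hf Hg) Hh)).
by rewrite mulrDl.
Qed.

(** * Scalar factors with constant fourth power *)

Section LocallyConstantFactor.
Variables (K : numFieldType) (D : set K).
Hypothesis oD : open D.

Lemma derive1n_cst (V : normedModType K) (a : V) (n : nat) :
  (fun=> a)^`(n.+1)%classic = (fun=> 0) :> (K -> V).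
Proof.
elim: n => [|n ih]; apply/funext => z; rewrite derive1nS ?ih derive1E.
  exact: derive_cst.
exact: derive_cst.
Qed.

Lemma smooth_cst (a : K) : smooth_on D (fun=> a).
Proof.
case=> [|n] z _; [rewrite derive1n0|rewrite derive1n_cst]; exact: derivable_cst.
Qed.

Lemma smooth_of_derive1_eq0 (c : K -> K) :
  (forall z, D z -> is_derive z 1 c 0) ->
  smooth_on D c /\ forall n z, D z -> c^`(n.+1)%classic z = 0.
Proof.
move=> c0.
have cn n z : D z -> c^`(n.+1)%classic z = 0.
  move=> Dz; rewrite derive1Sn (eq_on_derive1n oD (g := fun=> 0) n _ Dz).
    by case: n => // n; rewrite derive1n_cst.
  by move=> x Dx; rewrite derive1E; apply: derive_val; exact: c0.
split=> // -[|n] z Dz; first exact: (@ex_derive _ _ _ _ _ _ _ (c0 z Dz)).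
have H : is_derive z (1 : K) (fun=> 0 : K) 0 by exact: is_derive_cst.
apply: ex_derive; apply: (near_eq_is_derive _ H).
by near=> x; apply/esym/cn; near: x; exact: open_nbhs_nbhs.
Unshelve. all: by end_near. Qed.

(** Every Leibniz term but the last contains a derivative of [c] of positive order. *)
Lemma derive1n_scale_locally_cst (p q : nat) (c : K -> K)
    (F : K -> 'M[K]_(p, q)) :
  (forall z, D z -> is_derive z 1 c 0) ->
  (forall i j, smooth_on D (fun x => F x i j)) ->
  forall n z, D z -> (fun x => c x *: F x)^`(n)%classic z =
    c z *: F^`(n)%classic z.
Proof.
move=> c0 sF n z Dz; have [sc cn] := smooth_of_derive1_eq0 c0.
rewrite (derive1n_scale oD sc sF _ Dz) big_ord_recr/= binn mul1r subnn.
rewrite big1 ?add0r// => i _.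
by rewrite -[(n - i)%N]prednK ?subn_gt0// (cn _ _ Dz) mulr0 scale0r.
Qed.

Lemma is_derive_root4 (u v : K -> K) (z : K) :
  D z -> (forall z, D z -> u z ^+ 4 = v z ^+ 4) -> (forall z, D z -> v z != 0) ->
  (forall z, D z -> derivable u z 1) -> (forall z, D z -> derivable v z 1) ->
  is_derive z 1 (fun x => u x / v x) 0.
Proof.
move=> Dz uv v0 du dv; set c := fun x => u x / v x.
have c4 x : D x -> c x * c x * c x * c x = 1.
  move=> Dx; transitivity (c x ^+ 4); first by rewrite !exprS expr0 mulr1 !mulrA.
  by rewrite /c exprMn exprVn uv// divff// expf_neq0// v0.
have dc : derivable c z 1.
  by apply: derivableM; [exact: du|apply: derivableV; [exact: v0|exact: dv]].
have H := derivableP dc; set l := 'D_1 c z in H.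
have H4 := is_derive_mul (is_derive_mul3 H H H) H.
have H1 : is_derive z 1 (fun x => c x * c x * c x * c x) 0.
  have Hc : is_derive z (1 : K) (fun=> 1 : K) 0 by exact: is_derive_cst.
  apply: (near_eq_is_derive _ Hc).
  by near=> x; apply/esym/c4; near: x; exact: open_nbhs_nbhs.
(* The product rule for [c ^ 4] is compared with the derivative of the constant 1. *)
have E : (4 * (c z * c z * c z)) * l = 0.
  rewrite -(derive_val (is_derive := H1)) (derive_val (is_derive := H4)); ring.
suff l0 : l = 0 by rewrite -l0.
move/eqP: E; rewrite mulf_eq0 => /orP[|/eqP//].
rewrite mulf_eq0 pnatr_eq0/= => /eqP c3; have := c4 z Dz.
by rewrite c3 mul0r => /eqP; rewrite eq_sym oner_eq0.
Unshelve. all: by end_near. Qed.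

End LocallyConstantFactor.

(** * The affine lifting *)

(** Cramer's rule for the last three coordinates: each numerator is the determinant [d] with one of
    the orders 1, 2, 3 replaced by 4. The sign of [k2] comes from exchanging two rows. *)
Lemma quartic_frame_coef (K : fieldType) (w x y : nat -> K)
    (s := fun i j k => w i * x j * y k - w i * x k * y j)
    (d := s 1%N 2%N 3%N + s 2%N 3%N 1%N + s 3%N 1%N 2%N)
    (k1 := (s 4%N 2%N 3%N + s 3%N 4%N 2%N + s 2%N 3%N 4%N) / d)
    (k2 := - ((s 4%N 1%N 3%N + s 3%N 4%N 1%N + s 1%N 3%N 4%N) / d))
    (k3 := (s 4%N 1%N 2%N + s 2%N 4%N 1%N + s 1%N 2%N 4%N) / d) :
  d != 0 ->
  [/\ w 4%N = k1 * w 1%N + k2 * w 2%N + k3 * w 3%N,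
      x 4%N = k1 * x 1%N + k2 * x 2%N + k3 * x 3%N &
      y 4%N = k1 * y 1%N + k2 * y 2%N + k3 * y 3%N].
Proof. by move=> d0; split; rewrite /k1 /k2 /k3 /d /s; field. Qed.

Lemma det_affine_jet (K : comNzRingType) (w x y : nat -> K)
    (s := fun i j k => w i * x j * y k - w i * x k * y j) :
  \det (\matrix_(i < 4, j < 4) [:: (i == 0%N :> nat)%:R; w i; x i; y i]`_j) =
  s 1%N 2%N 3%N + s 2%N 3%N 1%N + s 3%N 1%N 2%N.
Proof.
rewrite (det_mx4 (fun i j => [:: (i == 0%N)%:R; w i; x i; y i]`_j)) /=.
by rewrite /s; ring.
Qed.

(** A determinant is differentiated one row at a time; raising the order in row 1 or 2 repeats a
    row, so only 3 becoming 4 contributes. With [g3] this reads [Delta' = g3 Delta]. *)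
Lemma derivation_det3 (K : comNzRingType) (w x y : nat -> K)
    (s := fun i j k => w i * x j * y k - w i * x k * y j)
    (p := fun i j k => w i.+1 * x j * y k + w i * x j.+1 * y k + w i * x j * y k.+1)
    (ds := fun i j k => p i j k - (w i.+1 * x k * y j + w i * x k.+1 * y j +
      w i * x k * y j.+1)) :
  ds 1%N 2%N 3%N + ds 2%N 3%N 1%N + ds 3%N 1%N 2%N =
  s 4%N 1%N 2%N + s 2%N 4%N 1%N + s 1%N 2%N 4%N.
Proof. by rewrite /ds /p /s; ring. Qed.

Section AffineCurve.
Variables (R : realType) (D : set (CC R)) (w x y : CC R -> CC R).
Hypotheses (oD : open D) (sw : smooth_on D w) (sx : smooth_on D x)
  (sy : smooth_on D y).

Lemma affine_liftingE j :
  (fun z => affine_lifting w x y z ord0 j) =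
  nth (fun=> 1) [:: fun=> 1; w; x; y] j.
Proof. by apply/funext => z; rewrite mxE; case: j => [[|[|[|[|]]]]]. Qed.

Lemma smooth_affine_lifting i j :
  smooth_on D (fun z => affine_lifting w x y z i j).
Proof.
rewrite ord1 affine_liftingE; case: j => [[|[|[|[|k]]]] jk].
- exact: smooth_cst.
- exact: sw.
- exact: sx.
- exact: sy.
- by exfalso.
Qed.

Lemma derive1n_affine_lifting n z : D z ->
  (affine_lifting w x y)^`(n)%classic z =
  row4 (n == 0%N)%:R (w^`(n)%classic z) (x^`(n)%classic z) (y^`(n)%classic z).
Proof.
move=> Dz; rewrite (derive1n_mx oD smooth_affine_lifting _ Dz).
apply/rowP => j; rewrite !mxE affine_liftingE.
case: j => [[|[|[|[|]]]]]//= _; case: n => [|n]//; by rewrite derive1n_cst.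
Qed.

Lemma det_jet_affine_lifting z : D z ->
  \det (jet (affine_lifting w x y) z) = Delta w x y z.
Proof.
move=> Dz.
rewrite -[RHS](det_affine_jet (fun i => w^`(i)%classic z)
  (fun i => x^`(i)%classic z) (fun i => y^`(i)%classic z)).
congr (\det _); apply/matrixP => i j.
by rewrite [LHS]mxE (derive1n_affine_lifting _ Dz) !mxE.
Qed.

Lemma is_derive_Delta z : D z -> is_derive z 1 (Delta w x y)
  (sigma w x y 4 1 2 z + sigma w x y 2 4 1 z + sigma w x y 1 2 4 z).
Proof.
move=> Dz.
pose H i j k := is_derive_mul3 (smooth_is_derive i sw Dz)
  (smooth_is_derive j sx Dz) (smooth_is_derive k sy Dz).
pose H' i j k := is_deriveB (H i j k) (H i k j).
apply: (is_derive_eq (is_deriveD (is_deriveD (H' 1 2 3) (H' 2 3 1)) (H' 3 1 2))).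
exact: (derivation_det3 (fun k => w^`(k)%classic z) (fun k => x^`(k)%classic z)
  (fun k => y^`(k)%classic z)).
Qed.

End AffineCurve.

(** The relation is expanded in the frame [v 0, ..., v 3] after replacing [v 4]. The coefficient of
    [v 3] vanishes by hypothesis, and independence makes the other three vanish separately. *)
Lemma scaled_frame_relation (K : fieldType) (v : nat -> 'rV[K]_4) (a : nat -> K)
    (k0 k1 k2 k3 c0 c1 c2 : K)
    (u := fun n => \sum_(i < n.+1) ('C(n, i)%:R * a (n - i)%N) *: v i) :
  row_free (\matrix_(i < 4) v i) ->
  v 4%N = k0 *: v 0%N + k1 *: v 1%N + k2 *: v 2%N + k3 *: v 3%N -> k0 = 0 ->
  4 * a 1%N + a 0%N * k3 = 0 ->
  u 4%N = c0 *: u 0%N + c1 *: u 1%N + c2 *: u 2%N <->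
  [/\ a 4%N - c0 * a 0%N - c1 * a 1%N - c2 * a 2%N = 0,
      4 * a 3%N + a 0%N * k1 - c1 * a 0%N - 2 * c2 * a 1%N = 0 &
      6 * a 2%N + a 0%N * k2 - c2 * a 0%N = 0].
Proof.
move=> free v4 k00 ak.
have uE : u 4%N - (c0 *: u 0%N + c1 *: u 1%N + c2 *: u 2%N) =
    (a 4%N - c0 * a 0%N - c1 * a 1%N - c2 * a 2%N) *: v 0%N +
    (4 * a 3%N + a 0%N * k1 - c1 * a 0%N - 2 * c2 * a 1%N) *: v 1%N +
    (6 * a 2%N + a 0%N * k2 - c2 * a 0%N) *: v 2%N +
    (4 * a 1%N + a 0%N * k3) *: v 3%N.
  rewrite /u !big_ord_recr !big_ord0/= v4 k00; apply/rowP => j; rewrite !mxE.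
  by rewrite /binomial/=; ring.
split=> [/eqP|[E0 E1 E2]].
  by rewrite -subr_eq0 uE => /eqP/(jet_lin_indep free)[].
by apply/eqP; rewrite -subr_eq0 uE E0 E1 E2 ak !scale0r !addr0.
Qed.

(** As a check on the exponents: all monomials have degree 4 in [a0, ..., a4], and if [ai] has
    weight [i] and [kj] weight [4 - j], the determinants are isobaric of weights 4, 3 and 2. So [k1]
    enters the first one through [a0 ^+ 3 * a1]. *)
Lemma det_curvature_matrices (K : comNzRingType) (a0 a1 a2 a3 a4 k0 k1 k2 k3 : K)
    (H : 'M[K]_(4, 5) := \matrix_(i < 4, j < 5)
    (nth [::]
      [:: [:: a0; a1; a2; a3; a4 + a0 * k0];
          [:: 0; a0; 2 * a1; 3 * a2; 4 * a3 + a0 * k1];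
          [:: 0; 0; a0; 3 * a1; 6 * a2 + a0 * k2];
          [:: 0; 0; 0; a0; 4 * a1 + a0 * k3]] i)`_j) : k0 = 0 ->
  [/\ \det (col' (inord 0) H) = a0 ^+ 3 * a1 * k1 + 6 * a0 * a1 ^+ 3 * k3
          - 12 * a0 * a1 ^+ 2 * a2 - 2 * a0 ^+ 2 * a1 ^+ 2 * k2
          - 3 * a0 ^+ 2 * a1 * a2 * k3 - 24 * a0 * a1 ^+ 2 * a2
          - 3 * a0 ^+ 2 * a1 * a2 * k3 + 24 * a1 ^+ 4
          + a0 ^+ 3 * a2 * k2 + 6 * a0 ^+ 2 * a2 ^+ 2
          + a0 ^+ 3 * a3 * k3 + 8 * a0 ^+ 2 * a1 * a3
          - a0 ^+ 3 * a4,
      \det (col' (inord 1) H) = a0 ^+ 4 * k1 - 2 * a0 ^+ 3 * a1 * k2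
          + 6 * a0 ^+ 2 * a1 ^+ 2 * k3 + 24 * a0 * a1 ^+ 3
          - 3 * a0 ^+ 3 * a2 * k3 - 24 * a0 ^+ 2 * a1 * a2
          + 4 * a0 ^+ 3 * a3 &
      \det (col' (inord 2) H) = 3 * a0 ^+ 3 * a1 * k3 + 12 * a0 ^+ 2 * a1 ^+ 2
          - 6 * a0 ^+ 3 * a2 - a0 ^+ 4 * k2].
Proof.
move=> k00.
pose e (i j : nat) := (nth [::]
      [:: [:: a0; a1; a2; a3; a4 + a0 * k0];
          [:: 0; a0; 2 * a1; 3 * a2; 4 * a3 + a0 * k1];
          [:: 0; 0; a0; 3 * a1; 6 * a2 + a0 * k2];
          [:: 0; 0; 0; a0; 4 * a1 + a0 * k3]] i)`_j.
(* Deleting column [k] means reading column [bump k j], which skips [k]; entries indexed by numbers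
   then compute. *)
have col'E k : (k < 5)%N ->
    col' (inord k) H = \matrix_(i < 4, j < 4) (fun i j => e i (bump k j)) i j.
  by move=> k5; apply/matrixP => i j; rewrite !mxE /= inordK.
split; rewrite col'E// (det_mx4 (fun i j => e i (bump _ j))) /e /bump/= k00; ring.
Qed.

Lemma row4_lin_comb (R : realType) (c1 c2 c3 : CC R) (w x y : nat -> CC R) :
  w 4%N = c1 * w 1%N + c2 * w 2%N + c3 * w 3%N ->
  x 4%N = c1 * x 1%N + c2 * x 2%N + c3 * x 3%N ->
  y 4%N = c1 * y 1%N + c2 * y 2%N + c3 * y 3%N ->
  row4 0 (w 4%N) (x 4%N) (y 4%N) = c1 *: row4 0 (w 1%N) (x 1%N) (y 1%N) +
    c2 *: row4 0 (w 2%N) (x 2%N) (y 2%N) + c3 *: row4 0 (w 3%N) (x 3%N) (y 3%N).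
Proof.
move=> Ew Ex Ey; apply/rowP => j; rewrite !mxE.
case: j => [[|[|[|[|k]]]] jk].
- by rewrite [LHS]/= [RHS]/= !mulr0 !addr0.
- exact: Ew.
- exact: Ex.
- exact: Ey.
- by exfalso.
Qed.

Section AffineCurveOnDisc.
Variables (R : realType) (D : set (CC R)) (w x y lam : CC R -> CC R).
Hypotheses (oD : open D) (sw : smooth_on D w) (sx : smooth_on D x)
  (sy : smooth_on D y) (sl : smooth_on D lam).
Hypothesis lamD : forall z, D z -> lam z ^+ 4 * Delta w x y z = 1.

Lemma Delta_neq0 z : D z -> Delta w x y z != 0.
Proof.
move=> Dz; apply/eqP => D0; have /eqP := lamD Dz.
by rewrite D0 mulr0 eq_sym oner_eq0.
Qed.

Lemma normalizing_factor_neq0 z : D z -> lam z != 0.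
Proof.
move=> Dz; apply/eqP => l0; have /eqP := lamD Dz.
by rewrite l0 expr0n mul0r eq_sym oner_eq0.
Qed.

Lemma affine_lifting_derive4 z : D z ->
  (affine_lifting w x y)^`(4)%classic z =
    g0 w x y z *: affine_lifting w x y z
    + g1 w x y z *: (affine_lifting w x y)^`(1)%classic z
    + g2 w x y z *: (affine_lifting w x y)^`(2)%classic z
    + g3 w x y z *: (affine_lifting w x y)^`(3)%classic z.
Proof.
move=> Dz; rewrite scale0r add0r !(derive1n_affine_lifting oD sw sx sy _ Dz).
have [Ew Ex Ey] := quartic_frame_coef (w := fun k => w^`(k)%classic z)
  (x := fun k => x^`(k)%classic z) (y := fun k => y^`(k)%classic z) (Delta_neq0 Dz).
exact: (row4_lin_comb (w := fun k => w^`(k)%classic z)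
  (x := fun k => x^`(k)%classic z) (y := fun k => y^`(k)%classic z) Ew Ex Ey).
Qed.

Lemma normalizing_factor_derive z : D z ->
  4 * lam^`(1)%classic z + lam z * g3 w x y z = 0.
Proof.
move=> Dz; have Hl := smooth_is_derive 0 sl Dz.
have HD := is_derive_Delta sw sx sy Dz; set d' := (_ + _ + _) in HD.
have H4 := is_derive_mul (is_derive_mul (is_derive_mul3 Hl Hl Hl) Hl) HD.
have H1 : is_derive z 1
    (fun z => lam z * lam z * lam z * lam z * Delta w x y z) 0.
  have Hc : is_derive z (1 : CC R) (fun=> 1 : CC R) 0 by exact: is_derive_cst.
  apply: (near_eq_is_derive _ Hc); near=> t.
  have Dt : D t by near: t; exact: open_nbhs_nbhs.
  by rewrite -[LHS](lamD Dt) !exprS expr0 mulr1 !mulrA.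
have E := derive_val (is_derive := H1); rewrite (derive_val (is_derive := H4)) in E.
clear H1 H4; have l0 := normalizing_factor_neq0 Dz; have D0 := Delta_neq0 Dz.
have -> : g3 w x y z = d' / Delta w x y z by [].
clearbody d'; clear HD Hl; move: E l0 D0; rewrite derive1n0.
move: (lam z) (lam^`(1)%classic z) (Delta w x y z) d' => l l1 d dd E l0 d0.
(* The derivative of [lam ^ 4 * Delta] is [lam ^ 3 * Delta] times the claimed expression. *)
apply: (mulfI (mulf_neq0 (expf_neq0 3 l0) d0)); rewrite mulr0 -[RHS]E.
by field.
Unshelve. all: by end_near. Qed.

End AffineCurveOnDisc.

(** * Analytic liftings and their curvatures *)

(** Entrywise coefficients assemble into vector coefficients, valid on the intersection of finitely
    many neighbourhoods. *)
Lemma analytic_on_rowP (R : realType) (n : nat) (D : set (CC R))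
    (f : CC R -> 'rV[CC R]_n) :
  analytic_on D f <-> forall i, analytic_on D (fun z => f z ord0 i).
Proof.
have serE (c : nat -> 'rV[CC R]_n) (b : CC R) i :
    (fun m => [series b ^+ k *: c k]_k m ord0 i) =
    [series b ^+ k *: (c k ord0 i)]_k.
  apply/funext => m; rewrite /series /= summxE.
  by apply: eq_bigr => k _; rewrite mxE.
split=> [fD i a Da|fD a Da].
  have [c fc] := fD a Da; exists (fun k => c k ord0 i).
  apply: filterS fc => z zc; rewrite -serE.
  exact: (iffLR (cvg_mxE _ _ _) zc ord0 i).
pose c i := sval (cid (fD i a Da)).
exists (fun k => \row_i c i k).
have : \forall z \near a, forall i, [series (z - a) ^+ k *: c i k]_k @ \oo --> f z ord0 i.
  exact: (filter_forall _ (fun i => svalP (cid (fD i a Da)))).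
move=> H; apply: filterS H => z zc; apply/cvg_mxE => i j; rewrite ord1 serE.
by under eq_fun do rewrite mxE; exact: zc.
Qed.

Lemma analytic_on_cst (R : realType) (D : set (CC R)) (b : CC R) :
  analytic_on D (fun=> b).
Proof.
move=> a Da; exists (fun n => if n is 0%N then b else 0).
(* The partial sum of index 0 is empty, so the sequence is constant only after a shift. *)
near=> z; rewrite -(cvg_shiftS [series _]_n).
have -> : (fun n => [series (z - a) ^+ k *: (if k is 0%N then b else 0)]_k n.+1) =
    fun=> b.
  apply/funext => n; rewrite /series /= big_nat_recl// expr0 scale1r.
  by rewrite big1 ?addr0// => i _; rewrite scaler0.
exact: cvg_cst.
Unshelve. all: by end_near. Qed.

Lemma unit_disc_open (R : realType) : open (unit_disc R).
Proof.
suff -> : unit_disc R = ball (0 : CC R) 1 by exact: ball_open.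
by apply/seteqP; split=> z; rewrite -ball_normE /ball_ /unit_disc/= sub0r normrN.
Qed.

Section Curvatures.
Variables (R : realType) (D : set (CC R)) (w x y lam : CC R -> CC R).
Hypotheses (oD : open D) (sw : smooth_on D w) (sx : smooth_on D x)
  (sy : smooth_on D y) (sl : smooth_on D lam).
Hypothesis lamD : forall z, D z -> lam z ^+ 4 * Delta w x y z = 1.
Hypothesis free : forall z, D z -> row_free (jet (affine_lifting w x y) z).

(** Being an equivalence at each point, this gives both that the formulas define curvatures and that
    no other values do. *)
Lemma normalized_lifting_equationP (z c0 c1 c2 : CC R)
    (nu := fun z => lam z *: affine_lifting w x y z) : D z ->
  nu^`(4)%classic z =
    c0 *: nu z + c1 *: nu^`(1)%classic z + c2 *: nu^`(2)%classic z <->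
  [/\ c0 = - Delta w x y z * \det (Hdel w x y lam (inord 0) z),
      c1 = Delta w x y z * \det (Hdel w x y lam (inord 1) z)
    & c2 = - Delta w x y z * \det (Hdel w x y lam (inord 2) z)].
Proof.
move=> Dz; have sF := smooth_affine_lifting sw sx sy.
have nuE n := derive1n_scale oD sl sF n Dz.
have tor := normalizing_factor_derive oD sw sx sy sl lamD Dz.
have := scaled_frame_relation (v := fun k => (affine_lifting w x y)^`(k)%classic z)
  (a := fun k => lam^`(k)%classic z) c0 c1 c2 (free Dz)
  (affine_lifting_derive4 oD sw sx sy lamD Dz) (erefl _) tor.
have [-> -> ->] := det_curvature_matrices (lam z) (lam^`(1)%classic z)
  (lam^`(2)%classic z) (lam^`(3)%classic z) (lam^`(4)%classic z)
  (g1 w x y z) (g2 w x y z) (g3 w x y z) (erefl (g0 w x y z)).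
have eqs := normalized_curvature_equations (lam^`(2)%classic z)
  (lam^`(3)%classic z) (lam^`(4)%classic z) (g1 w x y z) (g2 w x y z) c0 c1 c2
  (lamD Dz) tor.
rewrite -!nuE => H; exact: iff_trans H eqs.
Qed.

Lemma lifting_proportional (f2 : CC R -> 'rV[CC R]_4) (lam2 : CC R -> CC R) :
  (forall i j, smooth_on D (fun z => f2 z i j)) -> smooth_on D lam2 ->
  (forall z, D z -> f2 z = f2 z ord0 ord0 *: affine_lifting w x y z) ->
  (forall z, D z -> lam2 z ^+ 4 * \det (jet f2 z) = 1) ->
  exists2 c : CC R -> CC R, (forall z, D z -> c z != 0) &
    forall n z, D z -> (fun z => lam2 z *: f2 z)^`(n)%classic z =
      c z *: (fun z => lam z *: affine_lifting w x y z)^`(n)%classic z.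
Proof.
move=> sf2 sl2 f2E n2; set mu := fun z => f2 z ord0 ord0.
have sF := smooth_affine_lifting sw sx sy.
(* The second normalized lifting is [rho] times the affine one; comparing the two determinant
   conditions gives [rho ^ 4 = lam ^ 4]. *)
pose rho z := lam2 z * mu z.
have rho4 z : D z -> rho z ^+ 4 = lam z ^+ 4.
  move=> Dz; apply: (mulIf (Delta_neq0 lamD Dz)); rewrite lamD//.
  rewrite -(n2 z Dz) exprMn -mulrA; congr (_ * _).
  rewrite -(det_jet_affine_lifting oD sw sx sy Dz).
  have -> : jet f2 z =
      \matrix_(i < 4) (fun z => mu z *: affine_lifting w x y z)^`(i)%classic z.
    by apply/row_matrixP => i; rewrite !rowK; exact: (eq_on_derive1n oD _ f2E Dz).
  by rewrite (det_jet_scale oD (sf2 ord0 ord0) sF Dz).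
have l0 z (Dz : D z) := normalizing_factor_neq0 lamD Dz.
pose c z := rho z / lam z.
have c0 z : D z -> is_derive z 1 c 0.
  move=> Dz; apply: (is_derive_root4 oD Dz rho4 l0) => t Dt.
    exact: (smooth_mul oD sl2 (sf2 ord0 ord0) (n := 0) Dt).
  exact: (sl (n := 0) Dt).
exists c => [z Dz|n z Dz].
  rewrite mulf_neq0 ?invr_eq0 ?l0//.
  apply/eqP => r0; have /esym/eqP := rho4 z Dz.
  by rewrite r0 expr0n expf_eq0 (negPf (l0 z Dz)).
have snu i j : smooth_on D (fun z => (lam z *: affine_lifting w x y z) i j).
  have -> : (fun z => (lam z *: affine_lifting w x y z) i j) =
      (fun z => lam z * affine_lifting w x y z i j).
    by apply/funext => t; rewrite mxE.
  exact: (smooth_mul oD sl (sF i j)).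
rewrite -(derive1n_scale_locally_cst oD c0 snu n Dz).
apply: (eq_on_derive1n oD _ _ Dz) => t Dt.
by rewrite (f2E t Dt) scalerA [in RHS]scalerA /c divfK ?l0.
Qed.

End Curvatures.

Lemma scaler_lin_comb3 (K : comPzRingType) (V : lmodType K) (c k0 k1 k2 : K)
    (u0 u1 u2 : V) :
  c *: (k0 *: u0 + k1 *: u1 + k2 *: u2) =
  k0 *: (c *: u0) + k1 *: (c *: u1) + k2 *: (c *: u2).
Proof. by rewrite !scalerDr !scalerA ![c * _]mulrC. Qed.

Theorem mainTheorem6 (R : realType)
    (Phi : CC R -> {vspace 'rV[CC R]_4})
    (w x y lambda : CC R -> CC R)
    (hw : analytic_on (unit_disc R) w)
    (hx : analytic_on (unit_disc R) x)
    (hy : analytic_on (unit_disc R) y)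
    (hPhi : forall z, unit_disc R z ->
       Phi z = <[row4 1 (w z) (x z) (y z)]>%VS)
    (hfree : forall z, unit_disc R z ->
       row_free (jet (affine_lifting w x y) z))
    (hlambda : analytic_on (unit_disc R) lambda)
    (hnorm : forall z, unit_disc R z -> lambda z ^+ 4 * Delta w x y z = 1) :
  let f := affine_lifting w x y in
  let D := Delta w x y in
  let G0 := g0 w x y in let G1 := g1 w x y in
  let G2 := g2 w x y in let G3 := g3 w x y in
  let H := Hdel w x y lambda in
  [/\ is_lifting (unit_disc R) Phi f,
      forall z, unit_disc R z -> D z = \det (jet f z),
      forall z, unit_disc R z ->
        f^`(4)%classic z = G0 z *: f z + G1 z *: f^`(1)%classic z
                   + G2 z *: f^`(2)%classic z + G3 z *: f^`(3)%classic z,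
      forall kappa0 kappa1 kappa2 : CC R -> CC R,
        schwarzian_curvatures (unit_disc R) Phi kappa0 kappa1 kappa2 <->
        forall z, unit_disc R z ->
          [/\ kappa0 z = - D z * \det (H (inord 0) z),
              kappa1 z = D z * \det (H (inord 1) z)
            & kappa2 z = - D z * \det (H (inord 2) z)]
    & forall z, unit_disc R z ->
        let l0 := lambda z in
        let l1 := lambda^`(1)%classic z in
        let l2 := lambda^`(2)%classic z in
        let l3 := lambda^`(3)%classic z in
        let l4 := lambda^`(4)%classic z in
        [/\ - D z * \det (H (inord 0) z) =
            - D z * (l0 ^+ 3 * l1 * G1 z + 6 * l0 * l1 ^+ 3 * G3 z
                     - 12 * l0 * l1 ^+ 2 * l2 - 2 * l0 ^+ 2 * l1 ^+ 2 * G2 z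
                     - 3 * l0 ^+ 2 * l1 * l2 * G3 z - 24 * l0 * l1 ^+ 2 * l2
                     - 3 * l0 ^+ 2 * l1 * l2 * G3 z + 24 * l1 ^+ 4
                     + l0 ^+ 3 * l2 * G2 z + 6 * l0 ^+ 2 * l2 ^+ 2
                     + l0 ^+ 3 * l3 * G3 z + 8 * l0 ^+ 2 * l1 * l3
                     - l0 ^+ 3 * l4),
            D z * \det (H (inord 1) z) =
            D z * (l0 ^+ 4 * G1 z - 2 * l0 ^+ 3 * l1 * G2 z
                   + 6 * l0 ^+ 2 * l1 ^+ 2 * G3 z + 24 * l0 * l1 ^+ 3
                   - 3 * l0 ^+ 3 * l2 * G3 z - 24 * l0 ^+ 2 * l1 * l2
                   + 4 * l0 ^+ 3 * l3)
          & - D z * \det (H (inord 2) z) =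
            - D z * (3 * l0 ^+ 3 * l1 * G3 z + 12 * l0 ^+ 2 * l1 ^+ 2
                     - 6 * l0 ^+ 3 * l2 - l0 ^+ 4 * G2 z)]].
Proof.
move=> f D G0 G1 G2 G3 H; rewrite /f /D /G0 /G1 /G2 /G3 /H => {f D G0 G1 G2 G3 H}.
have oD := @unit_disc_open R.
have sw := analytic_smooth hw; have sx := analytic_smooth hx.
have sy := analytic_smooth hy; have sl := analytic_smooth hlambda.
have detE z (Dz : unit_disc R z) := det_jet_affine_lifting oD sw sx sy Dz.
have lift : is_lifting (unit_disc R) Phi (affine_lifting w x y).
  split=> [|z Dz].
    apply/analytic_on_rowP => j; rewrite affine_liftingE.
    case: j => [[|[|[|[|k]]]] jk].
    - exact: analytic_on_cst.
    - exact: hw.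
    - exact: hx.
    - exact: hy.
    - by exfalso.
  split; last exact: hPhi.
  apply/eqP => /rowP/(_ ord0) /eqP; rewrite !mxE.
  exact/negP/oner_neq0.
split.
- exact: lift.
- by move=> z Dz; rewrite detE.
- move=> z Dz; exact: (affine_lifting_derive4 oD sw sx sy hnorm Dz).
- move=> k0 k1 k2; split=> [|kE].
    case=> f2 [lam2 [[af2 f2Phi] _ alam2 n2 curv]] z Dz.
    have sf2 i j : smooth_on (unit_disc R) (fun z => f2 z i j).
      rewrite ord1; apply: analytic_smooth.
      exact: (iffLR (analytic_on_rowP _ _) af2 j).
    (* Both vectors span the line [Phi t]; the first affine coordinate is 1, so the factor is the
       first coordinate of [f2 t]. *)
    have f2E t : unit_disc R t -> f2 t = f2 t ord0 ord0 *: affine_lifting w x y t.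
      move=> Dt; have [_ Pt] := f2Phi t Dt; have := memv_line (f2 t).
      rewrite -Pt (hPhi t Dt) => /vlineP[k ->].
      by congr (_ *: _); rewrite !mxE mulr1.
    have [c c0 cE] := lifting_proportional oD sw sx sy sl hnorm sf2
      (analytic_smooth alam2) f2E (fun t Dt => proj2 (n2 t Dt)).
    apply/(normalized_lifting_equationP oD sw sx sy sl hnorm hfree _ _ _ Dz).
    apply: (scalerI (c0 z Dz)).
    (* Reading [nu2] as its own derivative of order 0 lets one proportionality statement rewrite all
       four terms. *)
    pose nu2 z := lam2 z *: f2 z.
    have : nu2^`(4)%classic z = k0 z *: nu2^`(0)%classic z +
      k1 z *: nu2^`(1)%classic z + k2 z *: nu2^`(2)%classic z := curv z Dz.
    rewrite (cE 0%N z Dz) (cE 4%N z Dz) (cE 1%N z Dz) (cE 2%N z Dz).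
    by move=> E; rewrite scaler_lin_comb3; exact: E.
  (* For the converse, the given affine lifting and factor serve as witnesses. *)
  exists (affine_lifting w x y), lambda; split.
  + exact: lift.
  + exact: hfree.
  + exact: hlambda.
  + move=> z Dz; split; first exact: (normalizing_factor_neq0 hnorm Dz).
    by rewrite detE ?hnorm.
  + move=> nu z Dz.
    apply/(normalized_lifting_equationP oD sw sx sy sl hnorm hfree _ _ _ Dz).
    exact: kE.
- move=> z Dz.
  have [E0 E1 E2] := det_curvature_matrices (lambda z) (lambda^`(1)%classic z)
    (lambda^`(2)%classic z) (lambda^`(3)%classic z) (lambda^`(4)%classic z)
    (g1 w x y z) (g2 w x y z) (g3 w x y z) (erefl (g0 w x y z)).
  exact: (And3 (congr1 (fun t => - Delta w x y z * t) E0)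
    (congr1 (fun t => Delta w x y z * t) E1)
    (congr1 (fun t => - Delta w x y z * t) E2)).
Qed.
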